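(* Consider a sequence of monomials $\boldsymbol{p}=(p_n)_{n\ge1}$ with $p_n(z)=a_n z^{d_n}$, $a_n\in\mathbb{C}\setminus\{0\}$ and integers $d_n\ge1$, and assume that $d_n\ge2$ for infinitely many $n$. Set $D_n:=\prod_{i=1}^n d_i$, and let $\boldsymbol{w}=(w_1,w_2,\dots)$ be a sequence of points in $\hat{\mathbb{C}}\setminus\{0,\infty\}$ such that $$\lim_{n\to+\infty}\frac{1}{D_n}\log|w_n|=0.$$ Consider the set $$E(\boldsymbol{w}):=\bigcup_{n=1}^{+\infty}\big(F^{(n)}_{\boldsymbol{p}}\big)^{-1}\{w_n\},$$ and let $E'(\boldsymbol{w})$ be the derived set of $E(\boldsymbol{w})$. Then $\mathscr{J}(\boldsymbol{p})=E'(\boldsymbol{w})$. In particular, for a point $w\in\hat{\mathbb{C}}\setminus\{0,\infty\}$ it holds that $\mathscr{J}(\boldsymbol{p})=E'(w)$, where $E'(w)$ is the derived set of $E(w):=\bigcup_{n=1}^{+\infty}\big(F^{(n)}_{\boldsymbol{p}}\big)^{-1}\{w\}$.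
   Context: $\hat{\mathbb{C}}=\mathbb{C}\cup\{\infty\}$ is the Riemann sphere with the spherical metric $\sigma$. For a sequence $\boldsymbol{f}=(f_n)_{n\ge1}$ of rational maps of $\hat{\mathbb{C}}$, put $F^{(n)}_{\boldsymbol{f}}:=f_n\circ\dots\circ f_1$. The Fatou set $\mathscr{F}(\boldsymbol{f})$ is the largest open subset of $\hat{\mathbb{C}}$ on which the family $\{F^{(n)}_{\boldsymbol{f}} : n\ge1\}$ is normal (every sequence in the family has a subsequence converging locally uniformly, with respect to $\sigma$, to a holomorphic map into $\hat{\mathbb{C}}$), and the Julia set is $\mathscr{J}(\boldsymbol{f}):=\hat{\mathbb{C}}\setminus\mathscr{F}(\boldsymbol{f})$. The derived set of $E\subseteq\hat{\mathbb{C}}$ is the set of all $z\in\hat{\mathbb{C}}$ that are limit points of $E\setminus\{z\}$ in $(\hat{\mathbb{C}},\sigma)$. *)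

(* Defs.v *)
From HB Require Import structures.
From mathcomp Require Import all_boot all_order all_algebra.
From mathcomp Require Import all_classical all_reals all_analysis.
From mathcomp Require Import complex ring lra.

Set Implicit Arguments.
Unset Strict Implicit.
Unset Printing Implicit Defensive.

Import Order.TTheory GRing.Theory Num.Theory.
Import numFieldNormedType.Exports.
Import ComplexField.Normc.

Local Open Scope classical_set_scope.
Local Open Scope ring_scope.
Local Open Scope complex_scope.

(* [Some z] is the finite point z and [None] is the point at infinity; the
   topology is the one of the spherical metric [sigma] below. *)
Definition sphere (R : realType) : Type := option R[i].

HB.instance Definition _ (R : realType) := Choice.copy (sphere R) (option R[i]).

Definition pt (R : realType) (z : R[i]) : sphere R := Some z.
Definition infty (R : realType) : sphere R := None.
Arguments infty {R}.

Section SphericalMetric.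
Variable R : realType.
Implicit Types (u v t : R * R * R) (p q r : sphere R).

(* Inverse stereographic projection onto the unit sphere of R^3, infinity going
   to the north pole. *)
Definition stereo p : R * R * R :=
  if p is Some (x +i* y) then
    let s := x ^+ 2 + y ^+ 2 in
    (2 * x / (s + 1), 2 * y / (s + 1), (s - 1) / (s + 1))
  else (0, 0, 1).

Definition dot3 u v : R := u.1.1 * v.1.1 + u.1.2 * v.1.2 + u.2 * v.2.

(* Great-circle distance between the images on the unit sphere, i.e., the
   distance induced by the Riemannian metric 2|dz|/(1+|z|^2). *)
Definition sigma p q : R := acos (dot3 (stereo p) (stereo q)).

Let sqs_gt0 (x y : R) : 0 < x ^+ 2 + y ^+ 2 + 1.
Proof. by rewrite ltr_wpDl// addr_ge0// sqr_ge0. Qed.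

Lemma stereo_unit p : dot3 (stereo p) (stereo p) = 1.
Proof.
case: p => [[x y]|]; rewrite /dot3/=; last by rewrite !mul0r !add0r mulr1.
by have := sqs_gt0 x y => s0; field; rewrite gt_eqF.
Qed.

Lemma dot3C u v : dot3 u v = dot3 v u.
Proof. by rewrite /dot3; ring. Qed.

Lemma dot3_itv u v : dot3 u u = 1 -> dot3 v v = 1 -> -1 <= dot3 u v <= 1.
Proof.
move: u v => [[a b] c] [[x y] z]; rewrite /dot3/= => h1 h2.
have := sqr_ge0 (a - x); have := sqr_ge0 (b - y); have := sqr_ge0 (c - z).
have := sqr_ge0 (a + x); have := sqr_ge0 (b + y); have := sqr_ge0 (c + z).
by rewrite !expr2 => *; apply/andP; split; lra.
Qed.

Lemma dot3_eq1 u v : dot3 u u = 1 -> dot3 v v = 1 -> dot3 u v = 1 -> u = v.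
Proof.
move: u v => [[a b] c] [[x y] z]; rewrite /dot3/= => h1 h2 h3.
have h : (a - x) ^+ 2 + (b - y) ^+ 2 + (c - z) ^+ 2 = 0 by rewrite !expr2; lra.
have ax := sqr_ge0 (a - x); have by_ := sqr_ge0 (b - y).
have cz := sqr_ge0 (c - z).
have /eqP : (a - x) ^+ 2 = 0 by lra.
have /eqP : (b - y) ^+ 2 = 0 by lra.
have /eqP : (c - z) ^+ 2 = 0 by lra.
by rewrite !sqrf_eq0 !subr_eq0 => /eqP -> /eqP -> /eqP ->.
Qed.

(* Nonnegativity of the Gram determinant, which is det(u, v, t)^2. *)
Lemma dot3_gram u v t :
  dot3 u u = 1 -> dot3 v v = 1 -> dot3 t t = 1 ->
  (dot3 u v * dot3 v t - dot3 u t) ^+ 2 <=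
    (1 - dot3 u v ^+ 2) * (1 - dot3 v t ^+ 2).
Proof.
move=> hu hv ht; rewrite -subr_ge0.
suff -> : (1 - dot3 u v ^+ 2) * (1 - dot3 v t ^+ 2) -
    (dot3 u v * dot3 v t - dot3 u t) ^+ 2 =
    (u.1.1 * (v.1.2 * t.2 - v.2 * t.1.2)
     - u.1.2 * (v.1.1 * t.2 - v.2 * t.1.1)
     + u.2 * (v.1.1 * t.1.2 - v.1.2 * t.1.1)) ^+ 2 by exact: sqr_ge0.
transitivity (dot3 u u * dot3 v v * dot3 t t + 2 * dot3 u v * dot3 v t * dot3 u t
  - dot3 u u * dot3 v t ^+ 2 - dot3 v v * dot3 u t ^+ 2
  - dot3 t t * dot3 u v ^+ 2).
  by rewrite hu hv ht; ring.
by rewrite /dot3; ring.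
Qed.

Lemma stereo_inj : injective stereo.
Proof.
move=> [[x y]|] [[x' y']|]//=.
- have s0 := sqs_gt0 x y; have s0' := sqs_gt0 x' y'.
  set s := x ^+ 2 + y ^+ 2 in s0 *; set s' := x' ^+ 2 + y' ^+ 2 in s0' *.
  have n0 : s + 1 != 0 by rewrite gt_eqF.
  have n0' : s' + 1 != 0 by rewrite gt_eqF.
  move=> [ex ey es].
  have ss : s = s'.
    have e1 : (s - 1) / (s + 1) = 1 - 2 / (s + 1) by field.
    have e2 : (s' - 1) / (s' + 1) = 1 - 2 / (s' + 1) by field.
    move: es; rewrite e1 e2 => /addrI/oppr_inj.
    have two0 : (2 : R) != 0 by rewrite pnatr_eq0.
    by move=> /(mulfI two0)/invr_inj/addIr.
  move: ex ey; rewrite ss => /(mulIf (invr_neq0 n0')) ex.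
  move=> /(mulIf (invr_neq0 n0')) ey.
  by congr (Some (_ +i* _)); lra.
- by move=> [_ _ /divr1_eq h]; exfalso; lra.
- by move=> [_ _ /esym/divr1_eq h]; exfalso; lra.
Qed.

Let dot_itv p q : -1 <= dot3 (stereo p) (stereo q) <= 1.
Proof. by apply: dot3_itv; exact: stereo_unit. Qed.

Lemma sigmaxx p : sigma p p = 0.
Proof. by rewrite /sigma stereo_unit acos1. Qed.

Lemma sigma_positivity p q : sigma p q = 0 -> p = q.
Proof.
move=> /(congr1 (@cos R)); rewrite cos0 acosK; last first.
  by rewrite in_itv/= dot_itv.
by move=> h; apply/stereo_inj/dot3_eq1 => //; exact: stereo_unit.
Qed.

Lemma sigma_sym p q : sigma p q = sigma q p.
Proof. by rewrite /sigma dot3C. Qed.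

Lemma sigma_triangle q p r : sigma p r <= sigma p q + sigma q r.
Proof.
rewrite /sigma.
have [upi|upi] := leP pi (acos (dot3 (stereo p) (stereo q)) +
                          acos (dot3 (stereo q) (stereo r))).
  by rewrite (le_trans _ upi)// acos_lepi// dot_itv.
set a := dot3 _ _ in upi *; set b := dot3 (stereo q) _ in upi *.
set c := dot3 _ _.
have aI : -1 <= a <= 1 := dot_itv p q.
have bI : -1 <= b <= 1 := dot_itv q r.
have cI : -1 <= c <= 1 := dot_itv p r.
rewrite leNgt; apply/negP => lt.
have : cos (acos c) < cos (acos a + acos b).
  rewrite (@ltr_cos R) ?in_itv/= ?acos_ge0 ?acos_lepi//.
  by rewrite addr_ge0 ?acos_ge0//= ltW.
rewrite cosD !acosK ?in_itv//= !sin_acos//.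
apply/negP; rewrite -leNgt lerBlDr -lerBlDl.
have ha : 0 <= 1 - a ^+ 2 by case/andP: aI => *; nra.
rewrite -sqrtrM//.
apply: (le_trans (ler_norm _)); rewrite -sqrtr_sqr ler_wsqrtr//.
by apply: dot3_gram; exact: stereo_unit.
Qed.

End SphericalMetric.

HB.instance Definition _ (R : realType) := isMetric.Build R (sphere R)
  (@sigmaxx R) (@sigma_positivity R) (@sigma_sym R) (@sigma_triangle R).

Section Holomorphic.
Variable R : realType.
Implicit Types (p q : sphere R) (f : sphere R -> sphere R).

(* The inversion z |-> 1/z. *)
Definition sphere_inv p : sphere R :=
  if p is Some z then (if z == 0 then infty else pt z^-1) else pt 0.

(* The affine coordinate used around the point p: z if p is finite, 1/z if p is
   infinite; it takes the junk value 0 at the point outside of the chart. *)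
Definition chart p q : R[i] := odflt 0 (if p is Some _ then q else sphere_inv q).

Definition chart_inv p (z : R[i]) : sphere R :=
  if p is Some _ then pt z else sphere_inv (pt z).

(* Continuity at p ensures that the values of f near p are in the chart
   around f p. *)
Definition holomorphic_at f p : Prop :=
  {for p, continuous f} /\
  derivable (chart (f p) \o f \o chart_inv p : R[i]^o -> R[i]^o) (chart p p) 1.

Definition holomorphic_on (U : set (sphere R)) f : Prop :=
  forall p, U p -> holomorphic_at f p.

End Holomorphic.

Section FatouJulia.
Variable R : realType.
Implicit Types (f : nat -> sphere R -> sphere R) (U : set (sphere R)).

(* iter_seq f n = f n \o ... \o f 1; the map f 0 is not used. *)
Fixpoint iter_seq f (n : nat) : sphere R -> sphere R :=
  if n is m.+1 then f m.+1 \o iter_seq f m else idfun.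

Definition cvg_locally_uniformly U f g : Prop :=
  forall p, U p -> exists2 V, nbhs p V & {uniform U `&` V, f @ \oo --> g}.

Definition normal_family U (G : set (sphere R -> sphere R)) : Prop :=
  forall h : nat -> sphere R -> sphere R, (forall k, G (h k)) ->
  exists phi : nat -> nat, exists g : sphere R -> sphere R,
    [/\ {homo phi : i j / (i < j)%N},
        holomorphic_on U g &
        cvg_locally_uniformly U (h \o phi) g].

(* The largest open set of normality is the union of all of them. *)
Definition fatou f : set (sphere R) :=
  \bigcup_(U in [set U | open U /\
    normal_family U [set iter_seq f n | n in [set n | (1 <= n)%N]]]) U.

Definition julia f : set (sphere R) := ~` fatou f.

End FatouJulia.

Section Monomials.
Variable R : realType.

(* The map z |-> a z^d of the sphere, for a != 0 and d >= 1. *)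
Definition monomial (a : R[i]) (d : nat) (p : sphere R) : sphere R :=
  if p is Some z then pt (a * z ^+ d) else infty.

Definition monomials (a : nat -> R[i]) (d : nat -> nat) :
    nat -> sphere R -> sphere R :=
  fun n => monomial (a n) (d n).

Definition backward_set (f : nat -> sphere R -> sphere R) (w : nat -> sphere R) :
    set (sphere R) :=
  \bigcup_(n in [set n | (1 <= n)%N]) (iter_seq f n @^-1` [set w n]).

End Monomials.

(* Main.v *)
(* The n-th iterate is F_n(z) = A_n z^(D_n) with D_n --> +oo, so F_n^-1(w_n)
   consists of D_n equally spaced points on the circle |z| = r_n, where
   |F_n(z)| = |w_n| (|z| / r_n)^(D_n) and |w_n|^(1 / D_n) --> 1. Let K be the
   upper limit of these circles in the sphere. Since the points become dense on
   their circles, K is the derived set of the backward orbit. A point outside K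
   has a neighbourhood that lies, for all large n, either well inside or well
   outside the n-th circle, so that F_n is uniformly close to 0 or to infinity on
   it: K contains the Julia set. Conversely, along a subsequence of circles
   converging to the one through p in K, the iterates tend to 0 inside and to
   infinity outside, so no subsequence has a limit continuous at p. *)

Require Import Defs.
From mathcomp Require Import all_boot all_order all_algebra.
From mathcomp Require Import all_classical all_reals all_analysis.
From mathcomp Require Import complex ring lra.
Import Order.TTheory GRing.Theory Num.Theory.
Import numFieldNormedType.Exports.
Import ComplexField.Normc.
Local Open Scope classical_set_scope.
Local Open Scope ring_scope.
Local Open Scope complex_scope.

(** * The modulus as a real-valued function *)

Section ComplexModulus.
Context {R : realType}.
Implicit Types (z w : R[i]).

Lemma normr_normc z : `|z| = (normc z)%:C.
Proof. by case: z. Qed.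

Lemma normc_ge0 z : 0 <= normc z.
Proof. by case: z => x y; exact: sqrtr_ge0. Qed.

Lemma normc_gt0 z : (0 < normc z) = (z != 0).
Proof.
rewrite lt_def normc_ge0 andbT; congr negb; apply/eqP/eqP => [/eq0_normc//|->].
exact: normc0.
Qed.

Lemma normcX z n : normc (z ^+ n) = normc z ^+ n.
Proof.
by elim: n => [|n IH]; rewrite ?expr0 ?normc1// !exprS normcM IH.
Qed.

Lemma normc_real (x : R) : normc x%:C = `|x|.
Proof. by rewrite /= expr0n addr0 sqrtr_sqr. Qed.

Lemma normcB_sym z w : normc (z - w) = normc (w - z).
Proof. by rewrite -opprB normcN. Qed.

Lemma normcB_ge z w : `|normc z - normc w| <= normc (z - w).
Proof.
rewrite ler_norml; apply/andP; split.
  have := le_normcD (w - z) z; rewrite subrK normcB_sym; lra.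
by have := le_normcD (z - w) w; rewrite subrK; lra.
Qed.

Lemma nbhs_normcP z (A : set R[i]) :
  nbhs (z : R[i]^o) A <->
  exists2 e : R, 0 < e & forall w, normc (w - z) < e -> A w.
Proof.
split.
- move=> /nbhs_ballP[e /= e0 eA].
  (* The radius is a complex number; being positive, it has zero imaginary part. *)
  move: e0 eA; case: e => e e'; rewrite ltcE/= => /andP[/eqP -> e0] eA.
  exists e => // w we; apply: eA; rewrite /ball/= normr_normc ltcE/= eqxx/=.
  by rewrite normcB_sym.
- move=> [e e0 eA]; apply/nbhs_ballP; exists e%:C => /=; first by rewrite ltcR.
  by move=> w; rewrite /ball/= normr_normc ltcR normcB_sym => /eA.
Qed.

End ComplexModulus.

(** * Neighbourhoods for the spherical metric in terms of moduli *)

Section SphereTopology.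
Context {R : realType}.
Implicit Types (z w : R[i]) (p q : sphere R) (V : set (sphere R)).

Lemma nbhs_dot3P p V : nbhs p V <->
  exists2 e : R, 0 < e & forall q, 1 - e < dot3 (stereo p) (stereo q) -> V q.
Proof.
have itv q : -1 <= dot3 (stereo p) (stereo q) <= 1.
  by apply: dot3_itv; exact: stereo_unit.
split.
- move=> /nbhs_ballP[e /= e0 eV].
  (* The cap is there because [cos] is decreasing only between 0 and [pi]. *)
  pose t := Num.min e pi.
  have t0 : 0 < t by rewrite lt_min e0 pi_gt0.
  have tpi : t <= pi by rewrite ge_min lexx orbT.
  have ct : cos t < 1 by rewrite -cos0 ltr_cos// in_itv/= ?lexx ?pi_ge0// ltW.
  exists (1 - cos t); first by rewrite subr_gt0.
  move=> q; rewrite subKr => tq; apply: eV; rewrite /ball/= /sigma.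
  apply: (@lt_le_trans _ _ t); last by rewrite ge_min lexx.
  rewrite -(@ltr_cos R) ?in_itv/= ?acos_ge0 ?acos_lepi//.
  - by rewrite acosK// in_itv/= itv.
  - by rewrite tpi ltW.
- move=> [e e0 eV]; pose t := Num.min e 1.
  have t0 : 0 < t by rewrite lt_min e0 ltr01.
  have t1 : t <= 1 by rewrite ge_min lexx orbT.
  have te : t <= e by rewrite ge_min lexx.
  have tI : -1 <= 1 - t <= 1 by lra.
  apply/nbhs_ballP; exists (acos (1 - t)) => /=; first by apply: acos_gt0; lra.
  move=> q; rewrite /ball/= /sigma => qt; apply: eV.
  apply: (@le_lt_trans _ _ (1 - t)); first lra.
  have := qt; rewrite -(@ltr_cos R) ?in_itv/= ?acos_ge0 ?acos_lepi//.
  by rewrite !acosK// in_itv/=.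
Qed.

Lemma normc_sqrE z : normc z ^+ 2 = complex.Re z ^+ 2 + complex.Im z ^+ 2.
Proof. by case: z => x y; rewrite sqr_sqrtr// addr_ge0// sqr_ge0. Qed.

(** For unit vectors, one minus the dot product is half the squared chordal distance; this is the
    classical chordal formula. *)
Lemma dot3_stereo_pt z w : dot3 (stereo (pt z)) (stereo (pt w)) =
  1 - 2 * normc (w - z) ^+ 2 / ((1 + normc z ^+ 2) * (1 + normc w ^+ 2)).
Proof.
rewrite !normc_sqrE; case: z w => [x y] [x' y'] /=; rewrite /dot3/=.
by field; rewrite !gt_eqF// ?ltr_wpDr// ?ltr_wpDl// ?addr_ge0 ?sqr_ge0.
Qed.

Lemma dot3_stereo_infty z :
  dot3 (stereo infty) (stereo (pt z)) = 1 - 2 / (1 + normc z ^+ 2).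
Proof.
rewrite normc_sqrE; case: z => [x y] /=; rewrite /dot3/=.
by field; rewrite !gt_eqF// ?ltr_wpDr// ?ltr_wpDl// ?addr_ge0 ?sqr_ge0.
Qed.

Lemma nbhs_ptP z V : nbhs (pt z) V <->
  exists2 e : R, 0 < e & forall w, normc (w - z) < e -> V (pt w).
Proof.
have sq w : 0 <= normc w ^+ 2 by exact: sqr_ge0.
rewrite nbhs_dot3P; split=> -[e e0 eV].
- pose t := Num.min e 1; have t0 : 0 < t by rewrite lt_min e0 ltr01.
  have t1 : t <= 1 by rewrite ge_min lexx orbT.
  have te : t <= e by rewrite ge_min lexx.
  exists (t / 2); first lra.
  move=> w wz; apply: eV; rewrite dot3_stereo_pt ltrD2l ltrN2.
  apply: (@lt_le_trans _ _ t) => //.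
  rewrite ltr_pdivrMr; last by rewrite mulr_gt0// ltr_pwDl.
  have := sq z; have := sq w; set b := _ ^+ 2; set a := _ ^+ 2 => b0 a0.
  have : 2 * normc (w - z) ^+ 2 < t.
    by rewrite expr2; have := normc_ge0 (w - z); nra.
  have ta := mulr_ge0 (ltW t0) a0; have tb := mulr_ge0 (ltW t0) b0.
  by have := mulr_ge0 ta b0; lra.
- have := sq z; set s := normc z ^+ 2 => s0.
  (* With c = |w - z|^2, closeness to z gives 2c < t(1 + s)(1 + 2s + 2c). The first bound on [t]
     makes the part in c at most c and rules out infinity; the second makes the rest at most e^2, so
     c < e^2. *)
  pose t := Num.min ((2 * (1 + s))^-1) (e ^+ 2 / ((1 + s) * (1 + 2 * s))).
  have p0 : 0 < (1 + s) * (1 + 2 * s) by nra.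
  have t0 : 0 < t.
    by rewrite lt_min; apply/andP; split;
       rewrite ?invr_gt0 ?divr_gt0 ?exprn_gt0//; nra.
  have t1 : t * (2 * (1 + s)) <= 1.
    rewrite -ler_pdivlMr ?div1r; last by lra.
    by rewrite ge_min lexx.
  have t2 : t * ((1 + s) * (1 + 2 * s)) <= e ^+ 2.
    by rewrite -ler_pdivlMr// ge_min lexx orbT.
  exists t => //; case=> [w|].
    rewrite dot3_stereo_pt ltrD2l ltrN2 -/s => h; apply: eV.
    have wle : normc w ^+ 2 <= 2 * s + 2 * normc (w - z) ^+ 2.
      have : normc w <= normc z + normc (w - z).
        by have := le_normcD z (w - z); rewrite addrC subrK.
      rewrite /s; have := normc_ge0 w; have := normc_ge0 z.
      have := normc_ge0 (w - z); move: (normc w) (normc z) (normc (w - z)).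
      move=> a b c c0 b0 a0 abc.
      apply: (@le_trans _ _ ((b + c) ^+ 2)); first by rewrite lerXn2r// nnegrE; lra.
      by have := sqr_ge0 (b - c); rewrite !expr2; lra.
    move: h; rewrite ltr_pdivrMr; last by rewrite mulr_gt0// ltr_pwDl.
    move: wle; set b := normc w ^+ 2; set c := _ ^+ 2 => bc h.
    have c0 : 0 <= c by exact: sqr_ge0.
    have k0 : 0 <= t * (1 + s) by rewrite mulr_ge0; lra.
    have kb := ler_wpM2l k0 bc.
    have kc := ler_wpM2r c0 t1.
    have ce : c < e ^+ 2 by lra.
    by rewrite -(ltr_pXn2r (_ : 0 < 2)%N) ?nnegrE ?normc_ge0 ?ltW.
  rewrite /dot3 -/(dot3 _ _) dot3C dot3_stereo_infty -/s ltrD2l ltrN2.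
  rewrite ltr_pdivrMr; last lra.
  by move=> h; exfalso; lra.
Qed.

Lemma nbhs_inftyP V : nbhs infty V <->
  V infty /\ exists M : R, forall w, M < normc w -> V (pt w).
Proof.
rewrite nbhs_dot3P; split=> [[e e0 eV]|[Vi [M MV]]].
- split; first by apply: eV; rewrite stereo_unit ltrBlDr ltrDl.
  exists (Num.max 1 (2 / e)) => w; rewrite gt_max => /andP[w1 we].
  apply: eV; rewrite dot3_stereo_infty ltrD2l ltrN2.
  rewrite ltr_pdivrMr; last by rewrite ltr_pwDl// sqr_ge0.
  move: we; rewrite ltr_pdivrMr// => we.
  have : 0 < e * normc w * (normc w - 1) by rewrite !mulr_gt0//; lra.
  by lra.
- pose N := Num.max 1 M.
  have N1 : 1 <= N by rewrite le_max lexx.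
  have NM : M <= N by rewrite le_max lexx orbT.
  exists (2 / (1 + N ^+ 2)); first by rewrite divr_gt0// ltr_pwDl// sqr_ge0.
  case=> [w|//]; rewrite dot3_stereo_infty ltrD2l ltrN2.
  rewrite ltr_pM2l// ltf_pV2 ?posrE; do ?[by rewrite ltr_pwDl// sqr_ge0].
  rewrite ltrD2l.
  rewrite ltr_pXn2r ?nnegrE ?normc_ge0//; last lra.
  by move=> Nw; apply: MV; exact: le_lt_trans Nw.
Qed.

End SphereTopology.

(** * Points of the unit circle and their roots *)

Section Cis.
Context {R : realType}.
Implicit Types (s t : R).

Definition cis t : R[i] := cos t +i* sin t.

Lemma cis0 : cis 0 = 1.
Proof. by rewrite /cis cos0 sin0. Qed.

Lemma cisD s t : cis (s + t) = cis s * cis t.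
Proof. by rewrite /cis cosD sinD; simpc; congr (_ +i* _); ring. Qed.

Lemma cisX t n : cis t ^+ n = cis (n%:R * t).
Proof.
elim: n => [|n IH]; first by rewrite expr0 mul0r cis0.
by rewrite exprS IH -cisD -natr1; congr cis; ring.
Qed.

Lemma normc_cis t : normc (cis t) = 1.
Proof. by rewrite /= cos2Dsin2 sqrtr1. Qed.

Lemma cis_2pi : cis (2 * pi) = 1.
Proof. by rewrite /cis mulr_natl cos2pi sin2pi. Qed.

Lemma cis_neq1 t : 0 < t <= pi -> cis t != 1.
Proof.
move=> /andP[t0 tpi]; apply/negP => /eqP[ct _].
have : cos t < cos 0 by rewrite ltr_cos ?in_itv/= ?lexx ?pi_ge0 ?tpi ?ltW.
by rewrite ct cos0 ltxx.
Qed.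

Lemma cis_surj (v : R[i]) : normc v = 1 ->
  exists2 t, - pi <= t <= pi & cis t = v.
Proof.
case: v => x y /= /(congr1 (fun z => z ^+ 2)).
rewrite sqr_sqrtr ?addr_ge0 ?sqr_ge0// expr1n => xy.
have xI : -1 <= x <= 1.
  by have := sqr_ge0 y => y2; apply/andP; split; nra.
have ax0 := acos_ge0 xI; have axpi := acos_lepi xI.
have sy : sin (acos x) = `|y|.
  by rewrite sin_acos// -xy addrAC subrr add0r sqrtr_sqr.
have [y0|y0] := leP 0 y.
- exists (acos x); first by rewrite axpi (le_trans _ ax0)// oppr_le0 pi_ge0.
  by rewrite /cis acosK ?in_itv//= sy ger0_norm.
- exists (- acos x); first by rewrite lerN2 axpi (le_trans _ (pi_ge0 R))// oppr_le0.
  by rewrite /cis cosN sinN acosK ?in_itv//= sy ltr0_norm// opprK.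
Qed.

Lemma cis_near1 (e : R) : 0 < e ->
  exists2 h, 0 < h & forall t, `|t| < h -> normc (cis t - 1) < e.
Proof.
(* The bound is [e ^+ 2 / 2] because |cis t - 1|^2 = 2(1 - cos t). *)
move=> e0; have e2 : 0 < e ^+ 2 / 2 by rewrite divr_gt0// exprn_gt0.
have /cvgrPdist_lt/(_ _ e2) := @continuous_cos R 0.
move=> /nbhs_ballP[h /= h0 hP]; exists h => // t th.
have := hP t; rewrite /ball/= sub0r normrN cos0 => /(_ th) ct.
rewrite -(@ltr_pXn2r _ 2)// ?nnegrE ?normc_ge0 ?(ltW e0)//.
rewrite sqr_sqrtr ?addr_ge0 ?sqr_ge0// subr0.
have := cos2Dsin2 t; have := cos_le1 t => c1 sc.
by rewrite ger0_norm in ct; [lra|lra].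
Qed.

(** If v = cis t with |t| <= pi, the arguments t / n and (t + 2 pi) / n give n-th roots of v close
    to 1. Two roots are produced so that one of them can be chosen to avoid a prescribed point. *)
Lemma unit_roots_near1 (e : R) : 0 < e -> exists n0 : nat, forall n v,
  (n0 <= n)%N -> normc v = 1 -> exists u1 u2 : R[i],
    u1 != u2 /\ forall u, u = u1 \/ u = u2 ->
      [/\ u ^+ n = v, normc u = 1 & normc (u - 1) < e].
Proof.
move=> /cis_near1[h h0 he].
(* Both numerators t and t + 2 pi lie between -pi and 3 pi. *)
have [n1 hn1] : exists n1 : nat, 3 * pi / h < n1%:R.
  by exists (Num.bound (3 * pi / h)); apply: archi_boundP;
     rewrite ltW// divr_gt0// mulr_gt0// pi_gt0.
(* For n >= 2 the two arguments differ by 2 pi / n, at most [pi], so the roots are distinct. *)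
exists (maxn n1 2) => n v; rewrite geq_max => /andP[n1n n2].
have n0 : 0 < n%:R :> R by rewrite ltr0n (leq_trans _ n2).
have pi0 := pi_gt0 R.
have hn : 3 * pi / n%:R < h.
  rewrite ltr_pdivrMr// -ltr_pdivrMl// mulrC.
  by rewrite (lt_le_trans hn1)// ler_nat.
move=> /cis_surj[t /andP[t1 t2] tv].
have near s : - pi <= s <= 3 * pi -> cis s = v ->
    [/\ cis (s / n%:R) ^+ n = v, normc (cis (s / n%:R)) = 1 &
     normc (cis (s / n%:R) - 1) < e].
  move=> /andP[s1 s2] sv; split; last 1 first.
  - apply: he; apply: le_lt_trans hn; rewrite normrM normfV.
    rewrite [`|n%:R|]gtr0_norm// ler_pM2r ?invr_gt0// ler_norml.
    by apply/andP; split; lra.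
  - by rewrite cisX mulrC divfK// gt_eqF.
  - exact: normc_cis.
exists (cis (t / n%:R)), (cis ((t + 2 * pi) / n%:R)); split.
  rewrite mulrDl cisD -subr_eq0 -{1}[cis (t / _)]mulr1 -mulrBr mulf_eq0 negb_or.
  rewrite -normc_gt0 normc_cis ltr01/= subr_eq0 eq_sym; apply: cis_neq1.
  rewrite divr_gt0 ?mulr_gt0//= ler_pdivrMr// mulrC ler_pM2l//.
  by rewrite (ler_nat _ 2).
move=> u [->|->]; apply: near => //; first by apply/andP; split; lra.
  by apply/andP; split; lra.
by rewrite cisD cis_2pi mulr1.
Qed.

End Cis.

(** * Monomials as maps of the sphere *)

Section Monomial.
Context {R : realType}.
Implicit Types (c z : R[i]) (p : sphere R).

Lemma derivable_monomial c n z :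
  derivable (fun x : R[i]^o => c * x ^+ n : R[i]^o) z 1.
Proof.
have dX : derivable (fun x : R[i]^o => x ^+ n : R[i]^o) (z : R[i]^o) 1.
  exact: exprn_derivable.
exact: (derivableZ dX).
Qed.

Lemma continuous_monomial c n p : c != 0 -> (0 < n)%N ->
  {for p, continuous (monomial c n)}.
Proof.
move=> c0 n0; case: p => [z|] V.
- move=> /nbhs_ptP[e e0 eV].
  have cz : {for z, continuous (fun x : R[i]^o => c * x ^+ n : R[i]^o)}.
    have /derivable1_diffP := derivable_monomial c n z.
    exact: differentiable_continuous.
  have /cz/nbhs_normcP[h h0 hP] : nbhs (c * z ^+ n : R[i]^o)
      [set x | normc (x - c * z ^+ n) < e].
    by apply/nbhs_normcP; exists e.
  by apply/nbhs_ptP; exists h => // x /hP; exact: eV.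
- move=> /nbhs_inftyP[Vi [M MV]]; apply/nbhs_inftyP; split=> //.
  have nc0 : 0 < normc c by rewrite normc_gt0.
  (* Beyond modulus 1, |x|^n is at least |x|. *)
  exists (Num.max 1 (M / normc c)) => x; rewrite gt_max => /andP[x1 xM].
  apply: MV; rewrite normcM normcX.
  move: xM; rewrite ltr_pdivrMr// mulrC => /lt_le_trans; apply.
  by rewrite ler_pM2l// ler_eXnr// ltW.
Qed.

Lemma holomorphic_monomial c n p : c != 0 -> (0 < n)%N ->
  holomorphic_at (monomial c n) p.
Proof.
move=> c0 n0; split; first exact: continuous_monomial.
case: p => [z|]; first exact: derivable_monomial.
suff -> : chart (monomial c n infty) \o monomial c n \o chart_inv infty =
    (fun x : R[i] => c^-1 * x ^+ n) by exact: derivable_monomial.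
apply/funext => x /=; case: (eqVneq x 0) => [->|x0] /=.
  by rewrite expr0n eqn0Ngt n0 mulr0.
rewrite /chart/= mulf_eq0 (negbTE c0) expf_eq0 invr_eq0 (negbTE x0) andbF/=.
by rewrite invfM exprVn invrK.
Qed.

Lemma holomorphic_cst (q p : sphere R) : holomorphic_at (cst q) p.
Proof.
split; first exact: cst_continuous.
exact: derivable_cst.
Qed.

Lemma finite_set_monomial_preimage c n (w : R[i]) : c != 0 -> (0 < n)%N ->
  finite_set (monomial c n @^-1` [set pt w]).
Proof.
move=> c0 n0; pose P := (c *: 'X^n - w%:P)%R : {poly R[i]}.
have P0 : P != 0.
  rewrite -size_poly_gt0 size_addl ?size_scale ?size_polyXn//.
  by rewrite size_opp (leq_ltn_trans (size_polyC_leq1 _)).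
have [rs rsP] := closed_field_poly_normal P.
apply: (sub_finite_set _ (finite_image (@pt R) (finite_seq rs))).
move=> [z|//] [zw]; exists z => //=.
have : root P z by rewrite /root !hornerE zw subrr.
by rewrite rsP rootZ ?lead_coef_eq0// root_prod_XsubC.
Qed.

End Monomial.

(** * Extraction of subsequences *)

Section Subsequences.

Lemma infinite_set_subseq (A : set nat) : infinite_set A ->
  exists2 f : nat -> nat, {homo f : i j / (i < j)%N} & forall k, A (f k).
Proof.
move=> Ainf.
have fin (n : nat) : finite_set [set y : nat | (y <= n)%O].
  apply: (@sub_finite_set _ _ `I_n.+1); last exact: finite_II.
  by move=> y /=; rewrite leEnat ltnS.
have [f [finc _ fA]] := infinite_increasing_seq_wf fin Ainf 0%N.
by exists f => // i j; rewrite ltnNge -(finc j i) leEnat -ltnNge.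
Qed.

Lemma homo_ltn_ge (f : nat -> nat) : {homo f : i j / (i < j)%N} ->
  forall k, (k <= f k)%N.
Proof.
move=> fh; elim=> [//|k IH]; exact: (leq_ltn_trans IH (fh _ _ (ltnSn k))).
Qed.

(** Serves normality: [m] lists the indices of a sequence of iterates and [b] selects between two
    limits. If no value of [m] recurs infinitely often, [m] tends to infinity, and one value of [b]
    recurs by pigeonhole. *)
Lemma nat_seq_subseq (m : nat -> nat) (b : nat -> bool) :
  exists2 f : nat -> nat, {homo f : i j / (i < j)%N} &
    (exists n, forall k, m (f k) = n) \/
    (exists c, (forall k, b (m (f k)) = c) /\
               forall N, exists K, forall k, (K <= k)%N -> (N <= m (f k))%N).
Proof.
have [[n ninf]|fin] := pselect (exists n, infinite_set [set k | m k = n]).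
  by have [f fh fn] := infinite_set_subseq _ ninf; exists f => //; left; exists n.
have finN N : finite_set [set k | (m k < N)%N].
  elim: N => [|N IH]; first by apply: sub_finite_set (finite_set0 _).
  apply: (@sub_finite_set _ _ ([set k | (m k < N)%N] `|` [set k | m k = N])).
    by move=> k /=; rewrite ltnS leq_eqVlt => /orP[/eqP|]; [right|left].
  rewrite finite_setU; split=> //.
  by apply: contrapT => Ninf; apply: fin; exists N.
have [c cinf] : exists c, infinite_set [set k | b (m k) = c].
  apply: contrapT => nc; have fc c : finite_set [set k | b (m k) = c].
    by apply: contrapT => cinf; apply: nc; exists c.
  apply: infinite_nat.
  apply: (@sub_finite_set _ _
    ([set k | b (m k) = true] `|` [set k | b (m k) = false])).
    by move=> k _ /=; case: (b (m k)); [left|right].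
  by rewrite finite_setU.
have [f fh fc] := infinite_set_subseq _ cinf.
exists f => //; right; exists c; split=> // N.
have [K KP] : exists K, forall k, (m k < N)%N -> (k < K)%N.
  have /finite_seqP[X XN] := finN N.
  exists (\max_(x <- X) x).+1 => k kN; rewrite ltnS.
  have kX : k \in X by have : [set k | (m k < N)%N] k by []; rewrite XN.
  exact: (@leq_bigmax_seq _ _ xpredT id).
exists K => k Kk; rewrite leqNgt; apply/negP => /KP; apply/negP.
by rewrite -leqNgt (leq_trans Kk)// (homo_ltn_ge _ fh).
Qed.

End Subsequences.

Lemma cvg_uniform_ballP (R : realType) (U : choiceType) (M : pseudoMetricType R)
    (B : set U) (h : nat -> U -> M) (g : U -> M) :
  {uniform B, h @ \oo --> g} <->
  forall e : R, 0 < e -> exists N, forall n, (N <= n)%N ->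
    forall q, B q -> ball (g q) e (h n q).
Proof.
split=> [hg e e0|hg P].
- have /hg[N _ NP] : nbhs (g : {uniform` B -> M})
      [set f | forall q, B q -> ball (g q) e (f q)].
    apply/uniform_nbhs; exists [set xy | ball xy.1 e xy.2].
    by split=> //; exact: entourage_ball (PosNum e0).
  by exists N => n Nn; exact: NP.
- move=> /uniform_nbhs[E [+ EP]]; rewrite -entourage_ballE => -[e /= e0 eE].
  have [N NP] := hg e e0; exists N => // n /= Nn.
  by apply: EP => q Bq; apply: eE; exact: NP.
Qed.

Lemma expr_unbounded (R : realType) (l M : R) : 1 < l ->
  exists N : nat, forall n, (N <= n)%N -> M < l ^+ n.
Proof.
move=> l1; have l0 : 0 < l - 1 by rewrite subr_gt0.
(* A weak form of Bernoulli's inequality. *)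
have bern n : n%:R * (l - 1) <= l ^+ n.
  elim: n => [|n IH]; first by rewrite mul0r expr0.
  have ln1 : 1 <= l ^+ n by rewrite exprn_ege1// ltW.
  by rewrite exprS -natr1; have := ler_wpM2r (ltW l0) ln1; lra.
exists (Num.bound (`|M| / (l - 1))) => n Nn.
apply: (le_lt_trans (ler_norm M)); apply: lt_le_trans (bern n).
rewrite -ltr_pdivrMr//; apply: (lt_le_trans (archi_boundP _)).
  by rewrite divr_ge0// ltW.
by rewrite ler_nat.
Qed.

(** * The upper limit of the circles, the derived set and the Julia set *)

Section LimitCircles.
Context {R : realType}.
Variables (A w : nat -> R[i]) (D : nat -> nat) (r : nat -> R).
Implicit Types (p q : sphere R) (z : R[i]) (V : set (sphere R)).

Hypothesis A_neq0 : forall n, A n != 0.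
Hypothesis w_neq0 : forall n, (1 <= n)%N -> w n != 0.
Hypothesis D_gt0 : forall n, (0 < D n)%N.
Hypothesis D_unbounded : forall M, exists N, forall n, (N <= n)%N -> (M <= D n)%N.
Hypothesis r_gt0 : forall n, (1 <= n)%N -> 0 < r n.
Hypothesis rE : forall n, (1 <= n)%N -> normc (A n) * r n ^+ D n = normc (w n).
(* Equivalent to (1 / D_n) log |w_n| --> 0. *)
Hypothesis w_subexp : forall l : R, 1 < l -> exists N, forall n, (N <= n)%N ->
  l ^- D n <= normc (w n) <= l ^+ D n.

Let F n : sphere R -> sphere R := monomial (A n) (D n).

(* The upper limit of the circles |z| = r_n, which carry the preimages
   F_n^-1(w_n). *)
Definition limit_circles : set (sphere R) := [set p | forall V, nbhs p V ->
  forall N, exists n, (N <= n)%N /\ exists2 z, V (pt z) & normc z = r n].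

(** A neighbourhood of a limit point still meets the preimages when those of finitely many indices,
    a finite set, are discarded. Conversely, a small rotation leads from a point of a late circle to
    a preimage on the same circle. *)
Lemma limit_point_limit_circles :
  limit_point (\bigcup_(n in [set n | (1 <= n)%N]) (F n @^-1` [set pt (w n)]))
  = limit_circles.
Proof.
apply/seteqP; split=> p pE V pV.
- move=> N.
  pose E := \bigcup_(n in [set n | (1 <= n < N)%N]) (F n @^-1` [set pt (w n)]).
  have Efin : finite_set (E `\ p).
    apply/finite_setD/bigcup_finite => [|n _].
      by apply: (@sub_finite_set _ _ `I_N) => // n /= /andP[].
    exact: finite_set_monomial_preimage.
  have Ecl : closed (E `\ p).
    have /accessible_finite_set_closed := hausdorff_accessible
      (@metric_hausdorff R (sphere R)).
    exact.
  have pV' : nbhs p (V `&` ~` (E `\ p)).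
    apply: filterI => //; apply: open_nbhs_nbhs; split; first exact: closed_openC.
    by case=> _; exact.
  have [q [qp [n /= n1 Fnq] [Vq nEq]]] := pE _ pV'.
  have Nn : (N <= n)%N.
    rewrite leqNgt; apply/negP => nN; apply: nEq; split; last exact/eqP.
    by exists n => //=; rewrite n1.
  exists n; split=> //; case: q qp Fnq Vq {nEq} => [z|//] _ [zw] Vz.
  exists z => //; have D0 := D_gt0 n.
  have := rE _ n1; rewrite -zw normcM normcX => /mulfI.
  rewrite gt_eqF ?normc_gt0// => /(_ isT)/esym/eqP.
  by rewrite eqrXn2 ?normc_ge0 ?(ltW (r_gt0 _ n1))// => /eqP.
(* On the circle, w_n / F_n(z) has modulus 1; multiplying z by its D_n-th roots near 1 gives
   preimages of w_n, with an error relative to |z|. *)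
- have roots (e : R) : 0 < e -> exists N, forall n z, (N <= n)%N ->
      normc z = r n -> exists z1 z2, z1 != z2 /\ forall x, x = z1 \/ x = z2 ->
      [/\ F n (pt x) = pt (w n), normc x = normc z & normc (x - z) <= e * normc z].
    move=> /(unit_roots_near1 _)[n0 n0P]; have [N NP] := D_unbounded n0.
    exists N.+1 => n z Nn zr; have n1 : (1 <= n)%N by exact: leq_trans Nn.
    have z0 : z != 0 by rewrite -normc_gt0 zr r_gt0.
    have zD0 : A n * z ^+ D n != 0 by rewrite mulf_neq0 ?expf_neq0.
    have [|u1 [u2 [u12 uP]]] := n0P (D n) (w n / (A n * z ^+ D n)) (NP _ (ltnW Nn)).
      rewrite normcM normcV normcM normcX zr (rE _ n1) divff//.
      by rewrite gt_eqF// normc_gt0 w_neq0.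
    exists (z * u1), (z * u2); split.
      by apply: contra u12 => /eqP/(mulfI z0)/eqP.
    have {}uP u : u = u1 \/ u = u2 -> [/\ F n (pt (z * u)) = pt (w n),
        normc (z * u) = normc z & normc (z * u - z) <= e * normc z].
      move=> /uP[uD un ue]; split.
      - by rewrite /F/= exprMn uD mulrA mulrC divfK.
      - by rewrite normcM un mulr1.
      - rewrite -[X in _ - X]mulr1 -mulrBr normcM mulrC ler_wpM2r ?normc_ge0//.
        exact: ltW.
    by move=> x [->|->]; apply: uP; [left|right].
  case: p pE pV => [z0|] pE pV.
  + have /nbhs_ptP[e e0 eV] := pV.
    have c0 : 0 < normc z0 + e by rewrite ltr_wpDl ?normc_ge0.
    (* Since |z| <= |z0| + e below, a relative error of this size moves z by at most e / 2. *)
    have h0 : 0 < e / 2 / (normc z0 + e) by rewrite !divr_gt0.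
    have [N NP] := roots _ h0.
    have [|n [Nn [z zV zr]]] := pE
      [set q | exists2 z, q = pt z & normc (z - z0) < e / 2] _ N.+1.
      by apply/nbhs_ptP; exists (e / 2); [lra|move=> z ze; exists z].
    case: zV => _ [<-] ze.
    have [z1 [z2 [z12 zP]]] := NP n z (ltnW Nn) zr.
    have zle : normc z <= normc z0 + e.
      by have := le_normcD (z - z0) z0; rewrite subrK; lra.
    have near x : x = z1 \/ x = z2 -> F n (pt x) = pt (w n) /\ V (pt x).
      move=> /zP[Fx _ xz]; split=> //; apply: eV.
      have xz' : normc (x - z) <= e / 2.
        apply: (le_trans xz); rewrite mulrAC ler_pdivrMr// ler_wpM2l//.
        by lra.
      by have := le_normcD (x - z) (z - z0); rewrite addrA subrK; lra.
    (* At most one of the two preimages is the centre [z0], which does not count for a limit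
       point. *)
    have [z1z0|z1z0] := eqVneq z1 z0.
      have [Fz Vz] := near z2 (or_intror erefl).
      exists (pt z2); split=> //; last by exists n => //; exact: leq_trans Nn.
      by apply: contra z12 => /eqP[->]; rewrite z1z0.
    have [Fz Vz] := near z1 (or_introl erefl).
    exists (pt z1); split=> //; by exists n => //; exact: leq_trans Nn.
  + have /nbhs_inftyP[Vi [M MV]] := pV.
    (* At infinity only the modulus of the preimage matters, so the relative error can be any
       positive number, here 1. *)
    have [N NP] := roots _ ltr01.
    have [|n [Nn [z zV zr]]] := pE
      [set q | if q is Some z then M < normc z else True] _ N.+1.
      by apply/nbhs_inftyP; split=> //; exists M.
    have [z1 [z2 [_ /(_ z1 (or_introl erefl))[Fz zz _]]]] := NP n z (ltnW Nn) zr.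
    exists (pt z1); split=> //; first by exists n => //; exact: leq_trans Nn.
    by apply: MV; rewrite zz.
Qed.


(** Here |F_n(z)| >= |w_n| l^(2 D_n) with l^2 = t / s. One factor l^(D_n) compensates |w_n| >=
    l^(-D_n), the other exceeds M. *)
Lemma monomial_large s t M : s < t -> exists N, forall n, (N <= n)%N ->
  r n <= s -> forall z, t <= normc z -> M < normc (A n * z ^+ D n).
Proof.
move=> st; have [s0|s0] := leP s 0.
  (* For s <= 0 the claim is vacuous, as the radii are positive from index 1 on. *)
  by exists 1%N => n n1 rs; have := r_gt0 _ n1; lra.
have t0 : 0 < t by exact: lt_trans st.
pose l := Num.sqrt (t / s).
have l2 : l ^+ 2 = t / s by rewrite sqr_sqrtr// divr_ge0// ltW.
have l1 : 1 < l by rewrite -sqrtr1 ltr_sqrt ?divr_gt0// ltr_pdivlMr// mul1r.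
have [N1 N1P] := w_subexp _ l1; have [N2 N2P] := expr_unbounded _ _ M l1.
have [N3 N3P] := D_unbounded N2.
exists (maxn 1 (maxn N1 N3)) => n; rewrite !geq_max => /and3P[n1 n2 n3] rs z tz.
apply: (lt_le_trans (N2P _ (N3P _ n3))); rewrite normcM normcX.
have lD : 0 < l ^+ D n by rewrite exprn_gt0// (lt_trans ltr01).
apply: (@le_trans _ _ (normc (A n) * (r n * l ^+ 2) ^+ D n)); last first.
  rewrite ler_wpM2l ?normc_ge0// lerXn2r ?nnegrE ?normc_ge0//.
    by rewrite mulr_ge0 ?sqr_ge0// ltW// r_gt0.
  apply: le_trans tz; rewrite l2 mulrA ler_pdivrMr// mulrC ler_pM2l//.
rewrite exprMn mulrA rE// -exprM mulnC exprM expr2.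
have /andP[+ _] := N1P _ n2.
by move=> /(ler_wpM2r (ltW lD)); rewrite mulVf ?gt_eqF// => h; nra.
Qed.

(** Inside the circle the same splitting gives |F_n(z)| l^(2 D_n) <= |w_n| <= l^(D_n), so |F_n(z)|
    is at most l^(-D_n), which is eventually below e. *)
Lemma monomial_small s t e : 0 < s -> s < t -> 0 < e ->
  exists N, forall n, (N <= n)%N ->
  t <= r n -> forall z, normc z <= s -> normc (A n * z ^+ D n) < e.
Proof.
move=> s0 st e0; have t0 : 0 < t by exact: lt_trans st.
pose l := Num.sqrt (t / s).
have l2 : l ^+ 2 = t / s by rewrite sqr_sqrtr// divr_ge0// ltW.
have l1 : 1 < l by rewrite -sqrtr1 ltr_sqrt ?divr_gt0// ltr_pdivlMr// mul1r.
have l0 : 0 <= l by exact: sqrtr_ge0.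
have [N1 N1P] := w_subexp _ l1; have [N2 N2P] := expr_unbounded _ _ e^-1 l1.
have [N3 N3P] := D_unbounded N2.
exists (maxn 1 (maxn N1 N3)) => n; rewrite !geq_max => /and3P[n1 n2 n3] rt z zs.
have lD : 0 < l ^+ D n by rewrite exprn_gt0// (lt_trans ltr01).
have le1 : 1 < e * l ^+ D n.
  by rewrite mulrC -ltr_pdivrMr// div1r; exact: N2P (N3P _ n3).
have zl : normc (A n * z ^+ D n) * (l ^+ D n * l ^+ D n) <= l ^+ D n.
  have /andP[_] := N1P _ n2; apply: le_trans.
  rewrite -(rE _ n1) normcM normcX -mulrA -expr2 -exprM mulnC exprM -exprMn.
  rewrite ler_wpM2l ?normc_ge0// lerXn2r//
    ?nnegrE ?mulr_ge0 ?normc_ge0 ?(ltW (r_gt0 _ n1))//.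
  apply: le_trans rt; rewrite l2 mulrA ler_pdivrMr// mulrC ler_wpM2l// ltW//.
rewrite -(ltr_pM2r lD); apply: le_lt_trans le1.
by rewrite -(ler_pM2r lD) mul1r -mulrA.
Qed.

(** Some neighbourhood of p misses all late circles. On a smaller one each late circle stays on one
    side, with a gap in modulus independent of n; [b n] records that the circle lies on the side of
    0, so that F_n is large. *)
Lemma not_limit_circles_dichotomy p : ~ limit_circles p ->
  exists U (b : nat -> bool), [/\ open U, U p &
    forall e : R, 0 < e -> exists N, forall n, (N <= n)%N ->
      forall q, U q -> ball (if b n then infty else pt 0) e (F n q)].
Proof.
move=> pnK.
have [V pV [N NV]] : exists2 V, nbhs p V & exists N, forall n, (N <= n)%N ->
    forall z, V (pt z) -> normc z <> r n.
  apply: contrapT => h; apply: pnK => V pV N; apply: contrapT => h'; apply: h.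
  exists V => //; exists N => n Nn z Vz zr; apply: h'; exists n; split=> //.
  by exists z.
suff [U [s1 [t1 [s2 [t2 [pU [s1t1 s20 s2t2] UP]]]]]] :
    exists U s1 t1 s2 t2, [/\ nbhs p U, [/\ s1 < t1, 0 < s2 & s2 < t2] &
    forall n, (maxn N 1 <= n)%N ->
      (r n <= s1 /\ forall z, U (pt z) -> t1 <= normc z) \/
      (t2 <= r n /\ forall q, U q -> exists2 z, q = pt z & normc z <= s2)].
  pose P n := r n <= s1 /\ forall z, U (pt z) -> t1 <= normc z.
  exists U°, (fun n => `[< P n >]); split=> //; first exact: open_interior.
  move=> e e0; have /nbhs_inftyP[ei [M MP]] := nbhsx_ballx (infty : sphere R) e e0.
  have /nbhs_ptP[c c0 cP] := nbhsx_ballx (pt 0 : sphere R) e e0.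
  have [N1 N1P] := monomial_large _ _ M s1t1.
  have [N2 N2P] := monomial_small _ _ _ s20 s2t2 c0.
  exists (maxn (maxn N 1) (maxn N1 N2)) => n; rewrite geq_max => /andP[n0].
  rewrite geq_max => /andP[n1 n2] q /interior_subset Uq.
  case: asboolP => [[rs Ut]|nP].
    by case: q Uq => [z Uz|_] //; apply: MP; apply: N1P => //; exact: Ut.
  case: (UP n n0) => [//|[rt /(_ q Uq)[z -> zs]]]; apply: cP; rewrite subr0.
  exact: N2P.
case: p pV {pnK} => [z0|] pV.
- have /nbhs_ptP[e e0 eV] := pV; have z00 := normc_ge0 z0.
  exists [set q | exists2 z, q = pt z & normc (z - z0) < e / 2].
  exists (normc z0 - e), (normc z0 - e / 2), (normc z0 + e / 2), (normc z0 + e).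
  split; [|split; lra|].
    by apply/nbhs_ptP; exists (e / 2); [lra|move=> z ze; exists z].
  move=> n; rewrite geq_max => /andP[Nn n1]; have rn0 := r_gt0 _ n1.
  have rz0 : e <= `|r n - normc z0|.
    rewrite leNgt; apply/negP => rz.
    (* The point of the n-th circle on the ray through [z0], or r_n itself if [z0] is 0; its
       distance to [z0] is the difference of the moduli. *)
    pose z := if z0 == 0 then (r n)%:C else z0 * (r n / normc z0)%:C.
    have zr : normc z = r n.
      rewrite /z; case: eqVneq => [_|]; first by rewrite normc_real gtr0_norm.
      rewrite -normc_gt0 => nz0; rewrite normcM normc_real gtr0_norm ?divr_gt0//.
      by rewrite mulrC divfK// gt_eqF.
    apply: (NV n Nn z) => //; apply: eV; apply: le_lt_trans rz; rewrite /z.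
    case: eqVneq => [->|]; first by rewrite normc0 !subr0 normc_real.
    rewrite -normc_gt0 => nz0.
    rewrite -[X in _ * _ - X]mulr1 -mulrBr -(rmorphB _ _ 1) normcM normc_real.
    by rewrite -{1}(gtr0_norm nz0) -normrM mulrBr mulr1 mulrC divfK// gt_eqF.
  move: rz0; rewrite ler_normr => /orP[rz|rz]; [right|left]; split; try lra.
  + move=> _ [z -> ze]; exists z => //.
    by have := normcB_ge z z0; rewrite ler_norml => /andP[_]; lra.
  + move=> z [_ [<-] ze].
    by have := normcB_ge z z0; rewrite ler_norml => /andP[+ _]; lra.
- have /nbhs_inftyP[Vi [M MV]] := pV.
  (* Late circles have radius at most M, so the first alternative always holds; 1 and 2 only have to
     satisfy 0 < 1 < 2. *)
  exists [set q | if q is Some z then M + 1 < normc z else True], M, (M + 1), 1, 2.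
  split; [|split; lra|].
    by apply/nbhs_inftyP; split=> //; exists (M + 1).
  move=> n; rewrite geq_max => /andP[Nn n1]; left; split=> [|z /ltW//].
  rewrite leNgt; apply/negP => Mr; have rr : normc (r n)%:C = r n.
    by rewrite normc_real gtr0_norm// r_gt0.
  by apply: (NV n Nn (r n)%:C) => //; apply: MV; rewrite rr.
Qed.

Variable f : nat -> sphere R -> sphere R.
Hypothesis iter_seqE : forall n, iter_seq f n = F n.

(** A sequence of iterates either repeats one iterate along a subsequence, which is then the limit,
    or has a subsequence with indices tending to infinity and constant [b], whose limit is the
    constant infinity or 0. *)
Lemma not_limit_circles_fatou p : ~ limit_circles p -> Defs.fatou f p.
Proof.
move=> /not_limit_circles_dichotomy[U [b [oU Up Ub]]].
exists U => //; split=> // h hF.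
have /choice[m mP] : forall k, exists n, (1 <= n)%N /\ iter_seq f n = h k.
  by move=> k; have [n n1 nE] := hF k; exists n.
have [phi phih phiP] := nat_seq_subseq m b; exists phi.
have hm k : h (phi k) = F (m (phi k)) by have [_ <-] := mP (phi k).
case: phiP => [[n mn]|[c [bc minf]]].
- exists (F n); split=> //.
    by move=> q _; apply: holomorphic_monomial.
  move=> q _; exists setT; first exact: filterT.
  apply/cvg_uniform_ballP => e e0; exists 0%N => k _ x _ /=.
  by rewrite hm mn; exact: ballxx.
- exists (cst (if c then infty else pt 0)); split=> //.
    by move=> q _; exact: holomorphic_cst.
  move=> q _; exists setT; first exact: filterT.
  apply/cvg_uniform_ballP => e e0; have [N NP] := Ub e e0.
  have [K KP] := minf N; exists K => k Kk x [Ux _] /=.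
  by rewrite hm -(bc k); apply: NP => //; exact: KP.
Qed.

(** A limit [g] near p would be infinity just outside the limiting circle and 0 just inside, hence
    take both values at p. For p = 0 the inner value, and for p = infinity the outer one, comes from
    the fixed points 0 and infinity of the iterates. *)
Lemma limit_circles_julia p : limit_circles p -> julia f p.
Proof.
move=> pK [U [oU normU] Up].
(* The bound [k.+1] makes the indices positive and unbounded, while the circles come within 1 / (k +
   1) of p. *)
have /choice[m mP] : forall k : nat, exists n, (k.+1 <= n)%N /\
    exists2 z, ball p k.+1%:R^-1 (pt z) & normc z = r n.
  by move=> k; apply: pK; apply: nbhsx_ballx; rewrite invr_gt0.
have [k|phi [g [phih ghol gcvg]]] := normU (F \o m).
  by exists (m k); [have [+ _] := mP k; exact: leq_trans|rewrite iter_seqE].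
have mphi N k : (N <= k)%N -> (N < m (phi k))%N.
  move=> Nk; have [+ _] := mP (phi k); apply: leq_ltn_trans.
  exact: leq_trans (homo_ltn_ge _ phih k).
have m1 k : (1 <= m (phi k))%N by exact: leq_ltn_trans (mphi 0%N _ _).
(* Hence r (m (phi k)) tends to the modulus of p in [0, +oo]. *)
have rV V : nbhs p V -> exists K, forall k, (K <= k)%N ->
    exists2 z, V (pt z) & normc z = r (m (phi k)).
  move=> /nbhs_ballP[e /= e0 eV]; exists (Num.bound e^-1) => k Kk.
  have [_ [z zp zr]] := mP (phi k); exists z => //; apply: eV.
  apply: le_ball zp; rewrite -[leRHS]invrK lef_pV2 ?posrE ?invr_gt0//.
  apply: (le_trans (ltW (archi_boundP _))); first by rewrite invr_ge0 ltW.
  rewrite ler_nat (leq_trans Kk)// (leq_trans (homo_ltn_ge _ phih k))//.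
have gU q V : U q -> nbhs (g q) V -> exists K, forall k, (K <= k)%N ->
    V (F (m (phi k)) q).
  move=> Uq /nbhs_ballP[e /= e0 eV].
  have [W qW /cvg_uniform_ballP/(_ _ e0)[K KP]] := gcvg q Uq.
  by exists K => k Kk; apply: eV; apply: KP => //; split=> //; exact: nbhs_singleton.
have gE q c : U q -> (forall V, nbhs c V -> exists K, forall k, (K <= k)%N ->
    V (F (m (phi k)) q)) -> g q = c.
  move=> Uq cP; apply: (@metric_hausdorff R (sphere R)) => V W Vg Wc.
  have [K1 K1P] := gU q V Uq Vg; have [K2 K2P] := cP W Wc.
  exists (F (m (phi (maxn K1 K2))) q); split.
    by apply: K1P; rewrite leq_maxl.
  by apply: K2P; rewrite leq_maxr.
(* By continuity of [g] at p, it is enough to find the value c arbitrarily close to p. *)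
have gpE c : (forall V, nbhs p V -> exists q, V q /\ (U q -> g q = c)) -> g p = c.
  move=> cP; apply: (@metric_hausdorff R (sphere R)) => V W Vg Wc.
  have [gc _] := ghol p Up.
  have pVU : nbhs p (g @^-1` V `&` U).
    by apply: filterI; [exact: gc|exact: open_nbhs_nbhs].
  have [q [[Vq Uq] /(_ Uq) gq]] := cP _ pVU.
  by exists c; split; [rewrite -gq|exact: nbhs_singleton].
have g_large s z : U (pt z) -> s < normc z ->
    (exists K, forall k, (K <= k)%N -> r (m (phi k)) <= s) -> g (pt z) = infty.
  move=> Uz sz [K KP]; apply: gE => // V /nbhs_inftyP[_ [M MV]].
  have [N NP] := monomial_large _ _ M sz.
  exists (maxn K N) => k; rewrite geq_max => /andP[Kk Nk]; apply: MV.
  by apply: NP => //; [exact: ltnW (mphi _ _ Nk)|exact: KP].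
have g_small s z : U (pt z) -> normc z < s ->
    (exists K, forall k, (K <= k)%N -> s <= r (m (phi k))) -> g (pt z) = pt 0.
  move=> Uz zs [K KP]; apply: gE => // V /nbhs_ptP[e e0 eV].
  have z0 := normc_ge0 z.
  have [||N NP] := monomial_small ((normc z + s) / 2) s e _ _ e0; [lra|lra|].
  exists (maxn K N) => k; rewrite geq_max => /andP[Kk Nk]; apply: eV.
  by rewrite subr0; apply: NP => //; [exact: ltnW (mphi _ _ Nk)|exact: KP|lra].
case: p pK Up mP rV gpE => [z0|] pK Up mP rV gpE.
- have z00 := normc_ge0 z0.
  have r_near e : 0 < e -> exists K, forall k, (K <= k)%N ->
      `|r (m (phi k)) - normc z0| < e.
    move=> e0; have [|K KP] := rV [set q | exists2 z, q = pt z & normc (z - z0) < e].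
      by apply/nbhs_ptP; exists e => // z ze; exists z.
    exists K => k /KP[z [_ [<-] ze] <-].
    exact: le_lt_trans (normcB_ge _ _) ze.
  have ginf : g (pt z0) = infty.
    apply: gpE => V /nbhs_ptP[e e0 eV].
    (* The point [z0] pushed radially outward by e / 2, past the late circles, whose radii stay
       below |z0| + e / 4. *)
    pose z := z0 + (if z0 == 0 then e / 2 else e / 2 / normc z0)%:C *
      (if z0 == 0 then 1 else z0).
    have [zn zz] : normc z = normc z0 + e / 2 /\ normc (z - z0) = e / 2.
      rewrite /z; have [->|] := eqVneq z0 0.
        by rewrite normc0 mulr1 !add0r subr0 normc_real gtr0_norm//; lra.
      rewrite -normc_gt0 => nz0; have h0 : 0 < e / 2 / normc z0 by rewrite !divr_gt0.
      rewrite addrAC subrr add0r normcM normc_real gtr0_norm// divfK ?gt_eqF//.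
      split=> //; rewrite -{1}[z0]mul1r -mulrDl -(rmorphD _ 1) normcM normc_real.
      by rewrite gtr0_norm ?addr_gt0// mulrDl mul1r divfK// gt_eqF.
    exists (pt z); split; first by apply: eV; rewrite zz; lra.
    move=> Uz; apply: (g_large (normc z0 + e / 4)) => //; first by rewrite zn; lra.
    have [|K KP] := r_near (e / 4); first lra.
    by exists K => k /KP; rewrite ltr_norml => /andP[_]; lra.
  suff gz : g (pt z0) = pt 0 by move: ginf; rewrite gz.
  have [z0E|] := eqVneq z0 0.
    rewrite z0E; apply: gE; first by rewrite -z0E.
    move=> V V0; exists 0%N => k _; rewrite /F/= expr0n gtn_eqF// mulr0.
    exact: nbhs_singleton.
  rewrite -normc_gt0 => nz0.
  apply: gpE => V /nbhs_ptP[e e0 eV].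
  (* Capping by |z0| keeps the inward push by t / 2 from crossing 0. *)
  pose t := Num.min e (normc z0).
  have t0 : 0 < t by rewrite lt_min e0.
  have te : t <= e by rewrite ge_min lexx.
  have tz : t <= normc z0 by rewrite ge_min lexx orbT.
  pose z := z0 - (t / 2 / normc z0)%:C * z0.
  have tz1 : t / 2 / normc z0 <= 1 by rewrite ler_pdivrMr// mul1r; lra.
  have h0 : 0 < t / 2 / normc z0 by rewrite !divr_gt0.
  have zn : normc z = normc z0 - t / 2.
    rewrite /z -{1}[z0]mul1r -mulrBl -(rmorphB _ 1) normcM normc_real.
    by rewrite ger0_norm ?subr_ge0// mulrBl mul1r divfK// gt_eqF.
  have zz : normc (z - z0) = t / 2.
    rewrite /z addrAC subrr add0r normcN normcM normc_real gtr0_norm// divfK//.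
    by rewrite gt_eqF.
  exists (pt z); split; first by apply: eV; rewrite zz; lra.
  move=> Uz; apply: (g_small (normc z0 - t / 4)) => //; first by rewrite zn; lra.
  have [|K KP] := r_near (t / 4); first lra.
  by exists K => k /KP; rewrite ltr_norml => /andP[+ _]; lra.
- have gi : g infty = infty.
    by apply: gE => // V Vi; exists 0%N => k _; exact: nbhs_singleton.
  suff : g infty = pt 0 by rewrite gi.
  apply: gpE => V /nbhs_inftyP[Vi [M MV]].
  pose M' := Num.max 0 M.
  have M'0 : 0 <= M' by rewrite le_max lexx.
  have MM' : M <= M' by rewrite le_max lexx orbT.
  have zn : normc (M' + 1)%:C = M' + 1 by rewrite normc_real ger0_norm//; lra.
  (* The late radii exceed M' + 2, so this point of [V] lies inside the late circles. *)
  exists (pt (M' + 1)%:C); split; first by apply: MV; rewrite zn; lra.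
  move=> Uz; apply: (g_small (M' + 2)) => //; first by rewrite zn; lra.
  have [|K KP] := rV [set q | if q is Some z then M' + 2 < normc z else True].
    by apply/nbhs_inftyP; split=> //; exists (M' + 2).
  by exists K => k /KP[z /= zM <-]; exact: ltW.
Qed.

Lemma julia_limit_circles : julia f = limit_circles.
Proof.
apply/seteqP; split=> p; last exact: limit_circles_julia.
by move=> pJ; apply: contrapT => /not_limit_circles_fatou.
Qed.

End LimitCircles.

(** * Compositions of monomials *)

Section MonomialSequence.
Context {R : realType}.
Variables (a : nat -> R[i]) (d : nat -> nat).
Hypothesis a_neq0 : forall n, (1 <= n)%N -> a n != 0.
Hypothesis d_ge1 : forall n, (1 <= n)%N -> (1 <= d n)%N.
Hypothesis d_ge2 : infinite_set [set n | (1 <= n)%N /\ (2 <= d n)%N].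

Let D n := (\prod_(1 <= i < n.+1) d i)%N.

Let DS n : D n.+1 = (D n * d n.+1)%N.
Proof. by rewrite /D big_nat_recr. Qed.

Let D_gt0 n : (0 < D n)%N.
Proof.
elim: n => [|n IH]; first by rewrite /D big_geq.
by rewrite DS muln_gt0 IH d_ge1.
Qed.

Let D_homo : {homo D : m n / (m <= n)%N}.
Proof.
apply: homo_leq => [//|m n p mn /(leq_trans mn)//|n].
by rewrite DS leq_pmulr// d_ge1.
Qed.

(** The products never decrease, and they grow strictly at each of the infinitely many indices with
    d_n >= 2. *)
Lemma prod_degrees_unbounded M :
  exists N, forall n, (N <= n)%N -> (M <= D n)%N.
Proof.
suff [N DN] : exists N, (M <= D N)%N.
  by exists N => n /D_homo; exact: leq_trans.
elim: M => [|M [N MN]]; first by exists 0%N.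
have [n [Nn dn]] : exists n, (N < n)%N /\ (2 <= d n)%N.
  apply: contrapT => h; apply: d_ge2.
  apply: (@sub_finite_set _ _ `I_N.+1); last exact: finite_II.
  move=> n /= [_ dn]; rewrite ltnS leqNgt; apply/negP => Nn.
  by apply: h; exists n.
exists n; case: n Nn dn => // n; rewrite ltnS => /D_homo DNn dn.
rewrite DS; apply: leq_ltn_trans (leq_trans MN DNn) _.
by rewrite -[ltnLHS]muln1 ltn_pmul2l.
Qed.

(** The coefficient A_n in F_n(z) = A_n z^(D_n). *)
Fixpoint iter_coef n : R[i] :=
  if n is m.+1 then a m.+1 * iter_coef m ^+ d m.+1 else 1.

Lemma iter_coef_neq0 n : iter_coef n != 0.
Proof.
elim: n => [|n IH] /=; first exact: oner_neq0.
by rewrite mulf_neq0 ?expf_neq0 ?a_neq0.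
Qed.

Lemma iter_seq_monomials n :
  iter_seq (monomials a d) n = monomial (iter_coef n) (D n).
Proof.
elim: n => [|n IH]; apply/funext; case=> [z|] //=.
- by rewrite /D big_geq// expr1 mul1r.
- by rewrite IH /monomials/= DS exprMn mulrA exprM.
- by rewrite IH.
Qed.

Lemma julia_monomials (w : nat -> R[i]) :
  (forall n, (1 <= n)%N -> w n != 0) ->
  ((D n)%:R^-1 * ln (normc (w n)) : R^o) @[n --> \oo] --> (0 : R^o) ->
  julia (monomials a d) =
    limit_point (backward_set (monomials a d) (fun n => pt (w n))).
Proof.
move=> w0 wcvg.
(* The D_n-th root of |w_n| / |A_n|, which is the modulus of the preimages of w_n for n >= 1. *)
pose r n := expR ((D n)%:R^-1 * ln (normc (w n) / normc (iter_coef n))).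
have Dr n : 0 < (D n)%:R :> R by rewrite ltr0n.
have expRD n (x : R) : expR ((D n)%:R^-1 * x) ^+ D n = expR x.
  by rewrite -expRM_natl mulrA divff ?mul1r ?gt_eqF.
have nA n : 0 < normc (iter_coef n) by rewrite normc_gt0 iter_coef_neq0.
have rE n : (1 <= n)%N -> normc (iter_coef n) * r n ^+ D n = normc (w n).
  move=> n1; rewrite /r expRD lnK ?posrE ?divr_gt0 ?normc_gt0 ?w0// -?normc_gt0//.
  by rewrite mulrC divfK// gt_eqF.
(* Obtained by exponentiating |ln |w_n|| < D_n ln l. *)
have w_subexp l : 1 < l -> exists N, forall n, (N <= n)%N ->
    l ^- D n <= normc (w n) <= l ^+ D n.
  move=> l1; have l0 : 0 < l by exact: lt_trans l1.
  have ll : 0 < ln l by rewrite ln_gt0.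
  have /cvgrPdist_lt/(_ _ ll)[N _ NP] := wcvg.
  exists (maxn N 1) => n; rewrite geq_max => /andP[/NP/= + n1].
  rewrite sub0r normrN normrM normfV (gtr0_norm (Dr n)) mulrC ltr_pdivrMr// => h.
  have wn : 0 < normc (w n) by rewrite normc_gt0 w0.
  move: h; rewrite ltr_norml mulr_natr -lnXn// => /andP[h1 h2].
  have lD : 0 < l ^+ D n by rewrite exprn_gt0.
  rewrite ltr_ln ?posrE// in h2.
  rewrite -lnV ?posrE// ltr_ln ?posrE ?invr_gt0// in h1.
  by rewrite !ltW.
have r0 n : (1 <= n)%N -> 0 < r n by move=> _; exact: expR_gt0.
(* Both sides are the upper limit of the circles. *)
rewrite (julia_limit_circles _ _ _ _ iter_coef_neq0 D_gt0
  prod_degrees_unbounded r0 rE w_subexp _ iter_seq_monomials).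
rewrite -(limit_point_limit_circles _ _ _ _ iter_coef_neq0 w0 D_gt0
  prod_degrees_unbounded r0 rE).
by congr limit_point; apply: eq_bigcupr => n _; rewrite iter_seq_monomials.
Qed.

End MonomialSequence.

Theorem theorem4p5 (R : realType) (a : nat -> R[i]) (d : nat -> nat)
    (a_neq0 : forall n, (1 <= n)%N -> a n != 0)
    (d_ge1 : forall n, (1 <= n)%N -> (1 <= d n)%N)
    (d_ge2 : infinite_set [set n | (1 <= n)%N /\ (2 <= d n)%N]) :
  (forall w : nat -> R[i],
     (forall n, (1 <= n)%N -> w n != 0) ->
     ((\prod_(1 <= i < n.+1) d i)%N%:R^-1 * ln (normc (w n)) : R^o)
       @[n --> \oo] --> (0 : R^o) ->
     julia (monomials a d) =
       limit_point (backward_set (monomials a d) (fun n => pt (w n)))) /\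
  (forall w : R[i], w != 0 ->
     julia (monomials a d) =
       limit_point (backward_set (monomials a d) (fun _ => pt w))).

Proof.
have main := julia_monomials a d a_neq0 d_ge1 d_ge2.
split=> [//|w w0]; apply: main => //.
(* For a constant sequence the logarithm is fixed while D_n tends to infinity. *)
apply/cvgrPdist_lt => e e0.
pose x := ln (normc w).
have [N NP] := prod_degrees_unbounded d d_ge1 d_ge2 (Num.bound (`|x| / e)).
exists N => // n /NP/= Dn; rewrite sub0r normrN normrM normfV -/x.
have Dr : `|x| / e < (\prod_(1 <= i < n.+1) d i)%N%:R.
  apply: (lt_le_trans (archi_boundP _)); last by rewrite ler_nat.
  by rewrite divr_ge0// ltW.
have D0 : 0 < (\prod_(1 <= i < n.+1) d i)%N%:R :> R.
  by apply: le_lt_trans Dr; rewrite divr_ge0// ltW.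
by rewrite (gtr0_norm D0) mulrC ltr_pdivrMr// mulrC -ltr_pdivrMr.
Qed.
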